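(* Let $A$ be a congruence-distributive algebra. Then $A$ has FCLP if and only if, for every $\phi\in\mathrm{Con}(A)$, the quotient algebra $A/\phi$ has FCLP. Likewise, $A$ has CBLP if and only if, for every $\phi\in\mathrm{Con}(A)$, $A/\phi$ has CBLP.
   Context: Algebras are non-empty universal algebras of a fixed arbitrary signature. For an algebra $A$, $\mathrm{Con}(A)$ is the bounded lattice of congruences of $A$ ordered by inclusion, with meet $\cap$, join $\phi\vee\psi$ = the congruence generated by $\phi\cup\psi$, least element $\Delta_A=\{(a,a)\mid a\in A\}$ and greatest element $\nabla_A=A^2$. $A$ is congruence-distributive if the lattice $\mathrm{Con}(A)$ is distributive; quotients of congruence-distributive algebras are congruence-distributive. For a bounded distributive lattice $L$, $\mathcal{B}(L)$ is the Boolean algebra of complemented elements of $L$. Composition: $\phi\circ\psi=\{(a,b)\in A^2\mid \exists x\in A,\ (a,x)\in\psi,\ (x,b)\in\phi\}$. Let $A$ be congruence-distributive. A congruence $\phi$ of $A$ is a factor congruence if there is $\phi^*\in\mathrm{Con}(A)$ with $\phi\vee\phi^*=\nabla_A$, $\phi\cap\phi^*=\Delta_A$ and $\phi\circ\phi^*=\phi^*\circ\phi$. $\mathrm{FC}(A)$ is the set of factor congruences; it is a Boolean subalgebra of $\mathcal{B}(\mathrm{Con}(A))$. For $\theta\in\mathrm{Con}(A)$ and $\alpha\in\mathrm{Con}(A)$ with $\theta\subseteq\alpha$, $\alpha/\theta=\{(a/\theta,b/\theta)\mid (a,b)\in\alpha\}\in\mathrm{Con}(A/\theta)$. The map $u_\theta:\mathrm{Con}(A)\to\mathrm{Con}(A/\theta)$,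 $u_\theta(\alpha)=(\alpha\vee\theta)/\theta$, is a bounded lattice morphism which maps $\mathrm{FC}(A)$ into $\mathrm{FC}(A/\theta)$ and $\mathcal{B}(\mathrm{Con}(A))$ into $\mathcal{B}(\mathrm{Con}(A/\theta))$. The congruence $\theta$ has FCLP (Factor Congruence Lifting Property) if the restriction $u_\theta|:\mathrm{FC}(A)\to\mathrm{FC}(A/\theta)$ is surjective; $\theta$ has CBLP (Congruence Boolean Lifting Property) if the restriction $u_\theta|:\mathcal{B}(\mathrm{Con}(A))\to\mathcal{B}(\mathrm{Con}(A/\theta))$ is surjective. $A$ has FCLP (respectively CBLP) if every congruence of $A$ has FCLP (respectively CBLP). *)

(* Defs.v *)
From HB Require Import structures.
From mathcomp Require Import all_boot all_order.
From mathcomp Require Import boolp classical_sets functions.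

Set Implicit Arguments.
Unset Strict Implicit.
Unset Printing Implicit Defensive.

Import Order.TTheory.

Local Open Scope classical_set_scope.

Record signature := Signature {
  op : Type;
  arity : op -> nat
}.

Record algebra (S : signature) := Algebra {
  carrier :> Type;
  interp : forall o : op S, ('I_(arity o) -> carrier) -> carrier;
  carrier_nonempty : inhabited carrier
}.

Arguments interp {S} a o.

Record is_congruence (S : signature) (A : algebra S) (R : set (A * A)) : Prop :=
  IsCongruence {
    is_congruence_refl : forall a, R (a, a);
    is_congruence_sym : forall a b, R (a, b) -> R (b, a);
    is_congruence_trans : forall a b c, R (a, b) -> R (b, c) -> R (a, c);
    is_congruence_interp : forall (o : op S) (a b : 'I_(arity o) -> A),
      (forall i, R (a i, b i)) -> R (interp A o a, interp A o b)
  }.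

Record con (S : signature) (A : algebra S) := Con {
  con_set :> set (A * A);
  conP : is_congruence con_set
}.

Lemma con_inj (S : signature) (A : algebra S) (x y : con A) :
  con_set x = con_set y -> x = y.
Proof.
case: x y => [x cx] [y cy] /= exy; subst y; congr Con; exact: Prop_irrelevance.
Qed.

Lemma is_congruence_diagonal (S : signature) (A : algebra S) :
  is_congruence (range (fun a : A => (a, a))).
Proof.
split => [a|_ _ [a _ [<- <-]]|_ _ _ [a _ [<- <-]] //|o a b ab].
- by exists a.
- by exists a.
- suff -> : a = b by exists (interp A o b).
  by apply: funext => i; case: (ab i) => c _ [<- <-].
Qed.

Lemma is_congruence_setT (S : signature) (A : algebra S) :
  is_congruence [set: A * A].
Proof. by []. Qed.

Lemma is_congruence_setI (S : signature) (A : algebra S) (x y : con A) :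
  is_congruence (x `&` y).
Proof.
case: x y => [x [x1 x2 x3 x4]] [y [y1 y2 y3 y4]] /=; split.
- by move=> a; split; [exact: x1|exact: y1].
- by move=> a b [xab yab]; split; [exact: x2|exact: y2].
- move=> a b c [xab yab] [xbc ybc].
  by split; [exact: x3 xab xbc|exact: y3 yab ybc].
- by move=> o a b ab; split; [apply: x4|apply: y4] => i; case: (ab i).
Qed.

Lemma is_congruence_smallest (S : signature) (A : algebra S) (X : set (A * A)) :
  is_congruence (smallest (@is_congruence S A) X).
Proof.
split.
- by move=> a R [[R1 R2 R3 R4] XR]; exact: R1.
- move=> a b ab R RX; have [[R1 R2 R3 R4] XR] := RX.
  by apply: R2; exact: (ab _ RX).
- move=> a b c ab bc R RX; have [[R1 R2 R3 R4] XR] := RX.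
  by apply: (R3 _ b); [exact: (ab _ RX)|exact: (bc _ RX)].
- move=> o a b ab R RX; have [[R1 R2 R3 R4] XR] := RX.
  by apply: R4 => i; exact: (ab i _ RX).
Qed.

Definition con_bot (S : signature) (A : algebra S) : con A :=
  Con (is_congruence_diagonal A).

Definition con_top (S : signature) (A : algebra S) : con A :=
  Con (is_congruence_setT A).

Definition con_meet (S : signature) (A : algebra S) (x y : con A) : con A :=
  Con (is_congruence_setI x y).

Definition con_gen (S : signature) (A : algebra S) (X : set (A * A)) : con A :=
  Con (is_congruence_smallest X).

Definition con_join (S : signature) (A : algebra S) (x y : con A) : con A :=
  con_gen (x `|` y).

Definition con_le (S : signature) (A : algebra S) : rel (con A) :=
  fun x y => `[< x `<=` y >].

Lemma con_le_refl (S : signature) (A : algebra S) : reflexive (@con_le S A).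
Proof. by move=> x; apply/asboolP. Qed.

Lemma con_le_anti (S : signature) (A : algebra S) : antisymmetric (@con_le S A).
Proof.
by move=> x y /andP[/asboolP xy /asboolP yx]; apply: con_inj; apply/seteqP.
Qed.

Lemma con_le_trans (S : signature) (A : algebra S) : transitive (@con_le S A).
Proof.
move=> y x z /asboolP xy /asboolP yz; apply/asboolP.
exact: subset_trans xy yz.
Qed.

Lemma con_lexI (S : signature) (A : algebra S) (x y z : con A) :
  con_le x (con_meet y z) = con_le x y && con_le x z.
Proof.
apply/asboolP/andP => /=; rewrite subsetI => -[].
  by move=> xy xz; split; apply/asboolP.
by move=> /asboolP xy /asboolP xz.
Qed.

Lemma con_leUx (S : signature) (A : algebra S) (x y z : con A) :
  con_le (con_join x y) z = con_le x z && con_le y z.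
Proof.
apply/asboolP/andP => [xyz|[/asboolP xz /asboolP yz]].
  have : x `|` y `<=` z.
    by apply: subset_trans xyz; exact: sub_gen_smallest.
  rewrite subUset => -[xz yz].
  by split; apply/asboolP.
by apply: smallest_sub; [exact: conP|rewrite subUset].
Qed.

Lemma con_le0x (S : signature) (A : algebra S) (x : con A) :
  con_le (con_bot A) x.
Proof.
by apply/asboolP => _ [a _ <-]; exact: (is_congruence_refl (conP x)).
Qed.

Lemma con_lex1 (S : signature) (A : algebra S) (x : con A) :
  con_le x (con_top A).
Proof. by apply/asboolP. Qed.

Fact con_display : Order.disp_t. Proof. exact: Order.Disp tt tt. Qed.

HB.instance Definition _ (S : signature) (A : algebra S) :=
  gen_eqMixin (con A).
HB.instance Definition _ (S : signature) (A : algebra S) :=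
  gen_choiceMixin (con A).
HB.instance Definition _ (S : signature) (A : algebra S) :=
  Order.Le_isPOrder.Build con_display (con A)
    (@con_le_refl S A) (@con_le_anti S A) (@con_le_trans S A).
HB.instance Definition _ (S : signature) (A : algebra S) :=
  Order.POrder_MeetJoin_isLattice.Build con_display (con A)
    (@con_lexI S A) (@con_leUx S A).
HB.instance Definition _ (S : signature) (A : algebra S) :=
  Order.hasBottom.Build con_display (con A) (@con_le0x S A).
HB.instance Definition _ (S : signature) (A : algebra S) :=
  Order.hasTop.Build con_display (con A) (@con_lex1 S A).

Lemma con_leP (S : signature) (A : algebra S) (x y : con A) :
  reflect (x `<=` y) (x <= y)%O.
Proof. exact: asboolP. Qed.

Lemma con_meetE (S : signature) (A : algebra S) (x y : con A) :
  con_set (x `&` y)%O = x `&` y.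
Proof. by []. Qed.

Lemma con_joinE (S : signature) (A : algebra S) (x y : con A) :
  con_set (x `|` y)%O = smallest (@is_congruence S A) (x `|` y).
Proof. by []. Qed.

Lemma con_botE (S : signature) (A : algebra S) :
  con_set (\bot%O : con A) = range (fun a : A => (a, a)).
Proof. by []. Qed.

Lemma con_topE (S : signature) (A : algebra S) :
  con_set (\top%O : con A) = [set: A * A].
Proof. by []. Qed.

Definition congruence_distributive (S : signature) (A : algebra S) : Prop :=
  forall x y z : con A, (x `&` (y `|` z) = (x `&` y) `|` (x `&` z))%O.

Definition complemented (d : Order.disp_t) (L : tbLatticeType d) : set L :=
  [set x | exists y : L, (x `|` y = \top /\ x `&` y = \bot)%O].

Arguments complemented {d} L _.

(* MathComp's relational composition [R \; R'] applies [R'] first. *)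
Definition con_comp (S : signature) (A : algebra S) (x y : con A) :
    set (A * A) :=
  (con_set x \; con_set y)%relation.

Definition factor_congruence (S : signature) (A : algebra S) : set (con A) :=
  [set x | exists y : con A,
     [/\ (x `|` y = \top)%O, (x `&` y = \bot)%O & con_comp x y = con_comp y x]].

Arguments factor_congruence {S} A _.

Definition con_class (S : signature) (A : algebra S) (t : con A) (a : A) :
    set A :=
  [set b | con_set t (a, b)].

Definition quo (S : signature) (A : algebra S) (t : con A) :=
  {C : set A | exists a, C = con_class t a}.

Lemma quo_eq (S : signature) (A : algebra S) (t : con A) (x y : quo t) :
  proj1_sig x = proj1_sig y -> x = y.
Proof.
case: x y => [x hx] [y hy] /= exy; subst y; congr exist; exact: Prop_irrelevance.
Qed.

Definition quo_pi (S : signature) (A : algebra S) (t : con A) (a : A) : quo t :=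
  exist _ (con_class t a) (ex_intro _ a erefl).

Definition quo_repr (S : signature) (A : algebra S) (t : con A) (x : quo t) : A :=
  projT1 (cid (projT2 x)).

Lemma quo_reprK (S : signature) (A : algebra S) (t : con A) :
  cancel (@quo_repr S A t) (quo_pi t).
Proof.
by move=> x; apply: quo_eq; rewrite /quo_repr /=; case: cid.
Qed.

Lemma quo_piP (S : signature) (A : algebra S) (t : con A) (a b : A) :
  quo_pi t a = quo_pi t b <-> con_set t (a, b).
Proof.
have [t1 t2 t3 _] := conP t; split => [[ab]|ab].
  suff : con_class t a b by [].
  by rewrite ab; exact: t1.
apply: quo_eq; apply/seteqP; split => c /=.
  by move=> ac; apply: t3 ac; exact: t2.
by move=> bc; exact: t3 ab bc.
Qed.

Definition quo_interp (S : signature) (A : algebra S) (t : con A) (o : op S)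
    (x : 'I_(arity o) -> quo t) : quo t :=
  quo_pi t (interp A o (fun i => quo_repr (x i))).

Lemma quo_nonempty (S : signature) (A : algebra S) (t : con A) :
  inhabited (quo t).
Proof. by case: (carrier_nonempty A) => a; exists; exact: quo_pi t a. Qed.

Definition quotient (S : signature) (A : algebra S) (t : con A) : algebra S :=
  Algebra (@quo_interp S A t) (quo_nonempty t).

Lemma interp_quo_pi (S : signature) (A : algebra S) (t : con A) (o : op S)
    (a : 'I_(arity o) -> A) :
  interp (quotient t) o (fun i => quo_pi t (a i)) = quo_pi t (interp A o a).
Proof.
apply/quo_piP; apply: (is_congruence_interp (conP t)) => i.
by apply/quo_piP; rewrite quo_reprK.
Qed.

Definition con_quo_set (S : signature) (A : algebra S) (t x : con A) :
    set (quotient t * quotient t) :=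
  [set (quo_pi t p.1, quo_pi t p.2) | p in x].

Arguments con_quo_set {S A} t x _.

Lemma con_quo_setP (S : signature) (A : algebra S) (t x : con A) :
  (t <= x)%O -> forall a b,
  con_quo_set t x (quo_pi t a, quo_pi t b) <-> con_set x (a, b).
Proof.
move=> /con_leP tx a b; split => [[[c d] /= xcd [ca db]]|xab].
  2: by exists (a, b).
have [x1 x2 x3 _] := conP x.
have xac : con_set x (a, c) by apply: tx; apply/quo_piP; apply: quo_eq.
have xdb : con_set x (d, b) by apply: tx; apply/quo_piP; apply: quo_eq.
exact: x3 xac (x3 _ _ _ xcd xdb).
Qed.

Lemma is_congruence_quo (S : signature) (A : algebra S) (t x : con A) :
  (t <= x)%O -> is_congruence (con_quo_set t x).
Proof.
move=> tx; have [x1 x2 x3 x4] := conP x; split.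
- by move=> a; rewrite -(quo_reprK a); apply/con_quo_setP.
- move=> a b; rewrite -(quo_reprK a) -(quo_reprK b).
  by move=> /(con_quo_setP tx) ab; apply/(con_quo_setP tx); exact: x2.
- move=> a b c; rewrite -(quo_reprK a) -(quo_reprK b) -(quo_reprK c).
  move=> /(con_quo_setP tx) ab /(con_quo_setP tx) bc.
  by apply/(con_quo_setP tx); exact: x3 ab bc.
- move=> o a b ab; apply/(con_quo_setP tx); apply: x4 => i.
  by apply/(con_quo_setP tx); rewrite !quo_reprK.
Qed.

Definition con_quo (S : signature) (A : algebra S) (t x : con A)
    (tx : (t <= x)%O) : con (quotient t) :=
  Con (is_congruence_quo tx).

Definition con_proj (S : signature) (A : algebra S) (t x : con A) :
    con (quotient t) :=
  con_quo (leUr t x : (t <= x `|` t)%O).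

Definition con_FCLP (S : signature) (A : algebra S) (t : con A) : Prop :=
  set_surj (factor_congruence A) (factor_congruence (quotient t)) (con_proj t).

Definition con_CBLP (S : signature) (A : algebra S) (t : con A) : Prop :=
  set_surj (complemented (con A)) (complemented (con (quotient t))) (con_proj t).

Definition FCLP (S : signature) (A : algebra S) : Prop :=
  forall t : con A, con_FCLP t.

Definition CBLP (S : signature) (A : algebra S) : Prop :=
  forall t : con A, con_CBLP t.

(* Main.v *)
(* Congruences of [A/t] correspond to congruences of [A] above [t] through
   inverse images along the projection, and this correspondence respects joins,
   meets, permutability and the maps [u].  Hence lifting for [A/phi] says: for
   [phi <= t], every complement of the interval [t, top] has the form [a \/ t]
   with [a] a complement of the interval [phi, top].  Taking [phi] to be the
   least congruence gives one direction.  For the other, lift to a complemented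
   [a] of [Con A] and replace it by [a \/ phi], which distributivity makes a
   complement in [phi, top]. *)
From HB Require Import structures.
From mathcomp Require Import all_boot all_order.
From mathcomp Require Import boolp classical_sets functions.
Require Import Defs.

Set Implicit Arguments.
Unset Strict Implicit.
Unset Printing Implicit Defensive.

Import Order.TTheory.

Local Open Scope classical_set_scope.

(** * Inverse images of congruences along the projection *)

Lemma is_congruence_pre (S : signature) (A : algebra S) (t : con A)
    (x : con (quotient t)) :
  is_congruence [set p : A * A | con_set x (quo_pi t p.1, quo_pi t p.2)].
Proof.
have [x1 x2 x3 x4] := conP x; split => /=.
- by move=> a; exact: x1.
- by move=> a b; exact: x2.
- by move=> a b c; exact: x3.
- by move=> o a b ab; rewrite -!interp_quo_pi; exact: x4.
Qed.

Definition con_pre (S : signature) (A : algebra S) (t : con A)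
    (x : con (quotient t)) : con A :=
  Con (is_congruence_pre x).

Lemma con_pre_le (S : signature) (A : algebra S) (t : con A)
    (x y : con (quotient t)) :
  (con_pre x <= con_pre y)%O = (x <= y)%O.
Proof.
apply/con_leP/con_leP => [xy [a b]|xy [a b]]; last exact: xy.
by rewrite -(quo_reprK a) -(quo_reprK b); exact: (xy (_, _)).
Qed.

Lemma con_pre_inj (S : signature) (A : algebra S) (t : con A) :
  injective (@con_pre S A t).
Proof. by move=> x y xy; apply: le_anti; rewrite -!con_pre_le xy !lexx. Qed.

Lemma con_pre_ge (S : signature) (A : algebra S) (t : con A)
    (x : con (quotient t)) :
  (t <= con_pre x)%O.
Proof.
apply/con_leP => -[a b] /quo_piP /= ->.
exact: (is_congruence_refl (conP x)).
Qed.

(** Every congruence above [t] is an inverse image; rewriting backwards with this moves statements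
    about such congruences to the quotient. *)
Lemma con_quoK (S : signature) (A : algebra S) (t x : con A) (tx : (t <= x)%O) :
  con_pre (con_quo tx) = x.
Proof. by apply: con_inj; apply/seteqP; split => -[a b] /(con_quo_setP tx). Qed.

Lemma con_preI (S : signature) (A : algebra S) (t : con A)
    (x y : con (quotient t)) :
  con_pre (x `&` y)%O = (con_pre x `&` con_pre y)%O.
Proof. exact: con_inj. Qed.

Lemma con_preU (S : signature) (A : algebra S) (t : con A)
    (x y : con (quotient t)) :
  con_pre (x `|` y)%O = (con_pre x `|` con_pre y)%O.
Proof.
apply: le_anti; rewrite leUx !con_pre_le leUl leUr !andbT.
have tz : (t <= con_pre x `|` con_pre y)%O by rewrite lexU2 ?con_pre_ge.
(* The join of the inverse images lies above [t], so it is an inverse image itself, and the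
   inequality can be checked in the quotient. *)
rewrite -[X in (_ <= X)%O](con_quoK tz) con_pre_le leUx -!con_pre_le con_quoK.
by rewrite leUl leUr.
Qed.

Lemma con_pre_bot (S : signature) (A : algebra S) (t : con A) :
  con_pre (\bot%O : con (quotient t)) = t.
Proof.
apply: le_anti; rewrite con_pre_ge andbT -[X in (_ <= X)%O](con_quoK (lexx t)).
by rewrite con_pre_le le0x.
Qed.

Lemma con_pre_top (S : signature) (A : algebra S) (t : con A) :
  con_pre (\top%O : con (quotient t)) = \top%O.
Proof. exact: con_inj. Qed.

Lemma con_pre_proj (S : signature) (A : algebra S) (t x : con A) :
  con_pre (con_proj t x) = (x `|` t)%O.
Proof. exact: con_quoK. Qed.

(** * Permuting congruences *)

Definition permuting (S : signature) (A : algebra S) (x y : con A) : Prop :=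
  con_comp x y = con_comp y x.

Lemma con_comp_pre (S : signature) (A : algebra S) (t : con A)
    (x y : con (quotient t)) (a b : A) :
  con_comp (con_pre x) (con_pre y) (a, b) <->
  con_comp x y (quo_pi t a, quo_pi t b).
Proof.
split=> [[c /= xac ycb]|[c /=]]; first by exists (quo_pi t c).
by rewrite -(quo_reprK c) => xac ycb; exists (quo_repr c).
Qed.

Lemma permuting_pre (S : signature) (A : algebra S) (t : con A)
    (x y : con (quotient t)) :
  permuting (con_pre x) (con_pre y) <-> permuting x y.
Proof.
split=> xy; apply/seteqP; split=> -[a b].
- rewrite -(quo_reprK a) -(quo_reprK b) => /con_comp_pre.
  by rewrite xy => /con_comp_pre.
- rewrite -(quo_reprK a) -(quo_reprK b) => /con_comp_pre.
  by rewrite -xy => /con_comp_pre.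
- by move=> /con_comp_pre; rewrite xy => /con_comp_pre.
- by move=> /con_comp_pre; rewrite -xy => /con_comp_pre.
Qed.

Lemma is_congruence_comp (S : signature) (A : algebra S) (x y : con A) :
  permuting x y -> is_congruence (con_comp x y).
Proof.
move=> xy; have [x1 x2 x3 x4] := conP x; have [y1 y2 y3 y4] := conP y; split.
- by move=> a; exists a => /=; [exact: y1|exact: x1].
- move=> a b; rewrite {1}xy => -[c /= xac ycb].
  by exists c => /=; [exact: y2|exact: x2].
- move=> a b c [d /= yad xdb] [e /= ybe xec].
  (* In the chain from [a] to [c] the two middle links are swapped, which brings the two [y]-links
     together, and likewise the two [x]-links. *)
  have : con_comp y x (d, e) by exists b.
  rewrite -xy => -[f /= ydf xfe].
  by exists f => /=; [exact: y3 yad ydf|exact: x3 xfe xec].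
- move=> o a b ab.
  have /choice[c abc] i : exists c, con_set y (a i, c) /\ con_set x (c, b i).
    by have [c] := ab i; exists c.
  by exists (interp A o c) => /=; [apply: y4|apply: x4] => i; case: (abc i).
Qed.

(** The composite of permuting congruences is a congruence containing both, hence contains their
    join. *)
Lemma permuting_join_top (S : signature) (A : algebra S) (x y : con A) :
  permuting x y -> (x `|` y = \top)%O -> con_comp x y = setT.
Proof.
move=> xy xyT; apply/seteqP; split=> // p _.
have : (x `|` y <= Con (is_congruence_comp xy))%O.
  rewrite leUx; apply/andP; split; apply/con_leP => -[a b] ab.
    by exists a => //; exact: (is_congruence_refl (conP y)).
  by exists b => //; exact: (is_congruence_refl (conP x)).
by rewrite xyT => /con_leP; apply.
Qed.

Lemma con_comp_mono (S : signature) (A : algebra S) (x y x' y' : con A) :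
  (x <= x')%O -> (y <= y')%O -> con_comp x y `<=` con_comp x' y'.
Proof.
by move=> /con_leP xx /con_leP yy [a b] [c ac cb]; exists c; [exact: yy|exact: xx].
Qed.

(** Both composites of [x] and [y] are already the full relation, and they stay full when the
    factors grow. *)
Lemma permuting_joinr (S : signature) (A : algebra S) (t x y : con A) :
  (x `|` y = \top)%O -> permuting x y ->
  permuting (x `|` t)%O (y `|` t)%O.
Proof.
move=> xyT xy; have xyE := permuting_join_top xy xyT.
have yxE : con_comp y x = setT by rewrite -xy.
rewrite /permuting; transitivity [set: A * A]; last symmetry.
  by apply/seteqP; split=> //; rewrite -xyE; apply: con_comp_mono; exact: leUl.
by apply/seteqP; split=> //; rewrite -yxE; apply: con_comp_mono; exact: leUl.
Qed.

(** * Relative complements and lifting *)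

(* [K] is instantiated with [permuting] for FCLP and with the trivial relation
   for CBLP.  [rel_compl K t x] says that [x] has a [K]-related complement in
   the interval from [t] to the top. *)
Definition rel_compl (S : signature)
    (K : forall B : algebra S, con B -> con B -> Prop) (A : algebra S)
    (t : con A) : set (con A) :=
  [set x | exists y : con A, [/\ (x `|` y = \top)%O, (x `&` y = t)%O & K A x y]].

Arguments rel_compl {S} K {A} t _.

Lemma rel_compl_le (S : signature)
    (K : forall B : algebra S, con B -> con B -> Prop) (A : algebra S)
    (t x : con A) :
  rel_compl K t x -> (t <= x)%O.
Proof. by move=> [y [_ <- _]]; exact: leIl. Qed.

Definition lifting (S : signature)
    (K : forall B : algebra S, con B -> con B -> Prop) (A : algebra S) : Prop :=
  forall t : con A, set_surj (rel_compl K (\bot%O : con A))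
    (rel_compl K (\bot%O : con (quotient t))) (con_proj t).

Lemma rel_compl_pre (S : signature)
    (K : forall B : algebra S, con B -> con B -> Prop)
    (K_pre : forall (A : algebra S) (t : con A) (x y : con (quotient t)),
      K A (con_pre x) (con_pre y) <-> K (quotient t) x y)
    (A : algebra S) (t : con A) (s x : con (quotient t)) :
  rel_compl K (con_pre s) (con_pre x) <-> rel_compl K s x.
Proof.
split=> -[y [xyT xyI xyK]]; last first.
  exists (con_pre y); split; last exact/K_pre.
    by rewrite -con_preU xyT con_pre_top.
  by rewrite -con_preI xyI.
(* The complement found in [A] lies above its meet with [con_pre x], hence above [t], and so
   descends to the quotient. *)
have ty : (t <= y)%O.
  by rewrite (le_trans (con_pre_ge s)) // -xyI leIr.
move: xyT xyI xyK; rewrite -(con_quoK ty) -con_preU -con_preI => xyT xyI xyK.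
exists (con_quo ty); split; last exact/K_pre.
  by apply: con_pre_inj; rewrite xyT con_pre_top.
exact: con_pre_inj.
Qed.

Lemma liftingE (S : signature)
    (K : forall B : algebra S, con B -> con B -> Prop)
    (K_pre : forall (A : algebra S) (t : con A) (x y : con (quotient t)),
      K A (con_pre x) (con_pre y) <-> K (quotient t) x y)
    (A : algebra S) :
  lifting K A <-> forall t x : con A, rel_compl K t x ->
    exists2 a, rel_compl K (\bot%O : con A) a & (a `|` t = x)%O.
Proof.
split=> [liftA t x tx|liftA t x].
  have := tx; rewrite -{1}(con_pre_bot t) -{1}(con_quoK (rel_compl_le tx)).
  move=> /(rel_compl_pre K_pre) /liftA[a a0 /(congr1 (@con_pre S A t))].
  by rewrite con_pre_proj con_quoK; exists a.
move=> /(rel_compl_pre K_pre); rewrite con_pre_bot => /liftA[a a0 atx].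
by exists a => //; apply: con_pre_inj; rewrite con_pre_proj.
Qed.

(** [liftingE] for [quotient phi] is pulled back to [A], so an iterated quotient never has to be
    identified with a quotient of [A]. *)
Lemma lifting_quotientE (S : signature)
    (K : forall B : algebra S, con B -> con B -> Prop)
    (K_pre : forall (A : algebra S) (t : con A) (x y : con (quotient t)),
      K A (con_pre x) (con_pre y) <-> K (quotient t) x y)
    (A : algebra S) (phi : con A) :
  lifting K (quotient phi) <->
  forall t x : con A, (phi <= t)%O -> rel_compl K t x ->
    exists2 a, rel_compl K phi a & (a `|` t = x)%O.
Proof.
rewrite (liftingE K_pre); split=> [lift t x pt tx|lift t x].
  have px := le_trans pt (rel_compl_le tx).
  have := tx; rewrite -{1}(con_quoK pt) -{1}(con_quoK px).
  move=> /(rel_compl_pre K_pre) /lift[a /(rel_compl_pre K_pre)].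
  rewrite con_pre_bot => a0 /(congr1 (@con_pre S A phi)).
  by rewrite con_preU !con_quoK; exists (con_pre a).
move=> /(rel_compl_pre K_pre) /(lift _ _ (con_pre_ge t))[a pa atx].
have := pa; rewrite -{1}(con_pre_bot phi) -{1}(con_quoK (rel_compl_le pa)).
move=> /(rel_compl_pre K_pre) a0; exists (con_quo (rel_compl_le pa)) => //.
by apply: con_pre_inj; rewrite con_preU con_quoK.
Qed.

(** By distributivity, joining with [t] also preserves meets; it sends bottom to [t] and top to top,
    so complements go to complements above [t]. *)
Lemma rel_compl_joinr (S : signature)
    (K : forall B : algebra S, con B -> con B -> Prop) (A : algebra S)
    (hA : congruence_distributive A)
    (K_joinr : forall t x y : con A, (x `|` y = \top)%O -> K A x y ->
      K A (x `|` t)%O (y `|` t)%O)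
    (t x : con A) :
  rel_compl K (\bot%O : con A) x -> rel_compl K t (x `|` t)%O.
Proof.
move=> [y [xyT xyI xyK]]; exists (y `|` t)%O; split; last exact: K_joinr.
  by rewrite joinACA xyT join1x.
by rewrite hA joinIK meetC hA [(y `&` x)%O]meetC xyI join0x meetUK.
Qed.

Lemma lifting_quotients (S : signature)
    (K : forall B : algebra S, con B -> con B -> Prop)
    (K_pre : forall (A : algebra S) (t : con A) (x y : con (quotient t)),
      K A (con_pre x) (con_pre y) <-> K (quotient t) x y)
    (A : algebra S) (hA : congruence_distributive A)
    (K_joinr : forall t x y : con A, (x `|` y = \top)%O -> K A x y ->
      K A (x `|` t)%O (y `|` t)%O) :
  lifting K A <-> forall phi : con A, lifting K (quotient phi).
Proof.
split=> [/(liftingE K_pre) liftA phi|liftq].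
  apply/(lifting_quotientE K_pre) => t x pt /liftA[a a0 atx].
  exists (a `|` phi)%O; first exact: rel_compl_joinr.
  by rewrite -joinA (join_idPr pt).
apply/(liftingE K_pre) => t x.
by have /(lifting_quotientE K_pre) := liftq \bot%O; apply; exact: le0x.
Qed.

Lemma complementedE (S : signature) (A : algebra S) :
  complemented (con A) =
  rel_compl (fun (B : algebra S) (_ _ : con B) => True) (\bot%O : con A).
Proof.
apply/seteqP; split=> x.
  by move=> [y [xyT xyI]]; exists y.
by move=> [y [xyT xyI _]]; exists y.
Qed.

Lemma CBLPE (S : signature) (A : algebra S) :
  CBLP A = lifting (fun (B : algebra S) (_ _ : con B) => True) A.
Proof.
by apply: eq_forall => t; rewrite /con_CBLP !complementedE.
Qed.

Theorem proposition3p9 (S : signature) (A : algebra S)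
    (hA : congruence_distributive A) :
  (FCLP A <-> (forall phi : con A, FCLP (quotient phi))) /\
  (CBLP A <-> (forall phi : con A, CBLP (quotient phi))).
Proof.
split.
  (* [FCLP] is convertible to [lifting] for [permuting]; [CBLP] is not convertible to its instance,
     as [complemented] has no third conjunct, and is rewritten by [CBLPE]. *)
  apply: (lifting_quotients (K := @permuting S)) => //.
  - by move=> B t x y; exact: permuting_pre.
  - by move=> t x y; exact: permuting_joinr.
rewrite CBLPE (eq_forall (fun phi => CBLPE (quotient phi))).
exact: lifting_quotients.
Qed.
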